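(* Let $f:(X,x)\to(Y,y)$ be a uniformly continuous pointed function between geodesic spaces (e.g. $X$ compact and $f$ continuous). Let $f_*:\pi_1(X,x)\to\pi_1(Y,y)$ be the induced homomorphism and let $\bar{h}_X:\pi_1(X,x)\to\bar{\pi}_1(X,x)$, $\bar{h}_Y:\pi_1(Y,y)\to\bar{\pi}_1(Y,y)$ be the quotient homomorphisms. Then there is a unique induced homomorphism $f_\sharp:\bar{\pi}_1(X,x)\to\bar{\pi}_1(Y,y)$ that satisfies $f_\sharp\circ\bar{h}_X=\bar{h}_Y\circ f_*$; it is defined by $$f_\sharp([\gamma]\pi_{cl}(X,x))=[f\circ\gamma]\pi_{cl}(Y,y).$$
   Context: A geodesic space is a metric space in which any two points are joined by a curve whose length equals the distance between them. Let $X$ be a geodesic space with base point $*$. For $\varepsilon>0$, an $\varepsilon$-chain is a finite sequence $\{x_0,\dots,x_n\}$ in $X$ with $d(x_{i-1},x_i)<\varepsilon$ for all $i$. A basic move adds or removes one point, keeping the endpoints fixed and keeping the result an $\varepsilon$-chain; two $\varepsilon$-chains are $\varepsilon$-homotopic if connected by finitely many basic moves. $\pi_\varepsilon(X,* )$ is the group, under concatenation, of $\varepsilon$-homotopy classes of $\varepsilon$-chains that start and end at $*$. A strong $\varepsilon$-chain along a path $\gamma:[a,b]\to X$ is an $\varepsilon$-chain $\{\gamma(t_0),\dots,\gamma(t_n)\}$ for a partition $a=t_0<\dots<t_n=b$ with $\gamma([t_{i-1},t_i])\subset B_\varepsilon(\gamma(t_{i-1}))\cap B_\varepsilon(\gamma(t_i))$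 for each $i$. The well-defined surjective homomorphism $h_\varepsilon:\pi_1(X,* )\to\pi_\varepsilon(X,* )$ sends $[\gamma]$ to the class of any strong $\varepsilon$-chain along $\gamma$. Put $K_\varepsilon( * )=\ker h_\varepsilon$, $\pi_{cl}(X,* )=\bigcap_{\varepsilon>0}K_\varepsilon( * )$, and $\bar{\pi}_1(X,* )=\pi_1(X,* )/\pi_{cl}(X,* )$ (revised fundamental group). *)

(* Defs.v *)
From HB Require Import structures.
From mathcomp Require Import all_boot all_order all_algebra.
From mathcomp Require Import generic_quotient.
From mathcomp Require Import all_classical all_reals ereal topology normedtype numfun.
From mathcomp Require Import interval_inference ring lra.

Set Implicit Arguments.
Unset Strict Implicit.
Unset Printing Implicit Defensive.

Import Order.TTheory GRing.Theory Num.Theory.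
Import numFieldTopology.Exports numFieldNormedType.Exports.

Local Open Scope classical_set_scope.
Local Open Scope ring_scope.

Section WithinContinuity.
Context {R : realType}.

Lemma within_comp (T U V : topologicalType) (A : set T) (B : set U)
    (f : T -> U) (g : U -> V) :
  {within A, continuous f} -> {within B, continuous g} ->
  {homo f : t / A t >-> B t} -> {within A, continuous (g \o f)}.
Proof.
move=> /subspace_continuousP cf /subspace_continuousP cg fAB.
apply/subspace_continuousP => x Ax.
apply: (@cvg_comp _ _ _ f g _ (within B (nbhs (f x)))); last exact/cg/fAB.
move=> W /= /(cf x Ax); apply: (@filterS _ (nbhs x) _ [set t | A t -> B (f t) -> W (f t)]
                               [set t | A t -> W (f t)]) => t /= tW At.
by apply: tW => //; exact: fAB.
Qed.

Lemma within_paste (T : topologicalType) (V : topologicalType) (A B C : set T)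
    (f g h : T -> V) : closed A -> closed B ->
  {within A, continuous f} -> {within B, continuous g} ->
  {in A, f =1 h} -> {in B, g =1 h} -> C `<=` A `|` B ->
  {within C, continuous h}.
Proof.
move=> Ac Bc cf cg fh gh CAB; apply: (continuous_subspaceW CAB).
apply: withinU_continuous => //.
- exact: (subspace_eq_continuous fh).
- exact: (subspace_eq_continuous gh).
Qed.

Lemma heine (T : pseudoMetricType R) (X : metricType R) (K : set T)
    (g : T -> X) (e : R) : compact K -> {within K, continuous g} -> 0 < e ->
  exists2 d : R, 0 < d &
    forall u v, K u -> K v -> ball u d v -> mdist (g u) (g v) < e.
Proof.
move=> cK /subspace_continuousP cg e0.
pose P (d : R) u := forall v, K v -> ball u d v -> mdist (g u) (g v) < e.
have : \forall d \near 0^'+, K `<=` P d.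
  have /near_covering_withinP := (iffLR (compact_near_coveringP K) cK).
  apply=> x Kx.
  have e20 : 0 < e / 2 by rewrite divr_gt0.
  have /(cg x Kx) : nbhs (g x) (ball (g x) (e / 2)) by exact: nbhsx_ballx.
  rewrite /= /within /= => /nbhs_ballP[d /= d0 dg].
  exists (ball x (d / 2), [set r | r < d / 2]) => /=.
    split; first by apply: nbhsx_ballx; rewrite divr_gt0.
    by apply: nbhs_right_lt; rewrite divr_gt0.
  move=> [x' r] /= [xx' rd] Kx' v Kv x'v.
  have xv : ball x d v.
    rewrite (splitr d); apply: ball_triangle xx' _.
    by apply: le_ball x'v; exact: ltW.
  have /dg/(_ Kv) := xv; rewrite ballEmdist/= => gxv.
  have /dg/(_ Kx') : ball x d x'.
    by apply: le_ball xx'; rewrite ler_pdivrMr// ler_pMr// ler1n.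
  rewrite ballEmdist/= => gxx'.
  rewrite (le_lt_trans (metric_triangle _ (g x) _))//.
  by rewrite (metric_sym (g x')) (splitr e) ltrD.
move=> nP; near (0 : R)^'+ => d.
have d0 : 0 < d by near: d; exact: nbhs_right_gt.
have KP : K `<=` P d by near: d; exact: nP.
by exists d => // u v Ku Kv; exact: KP.
Unshelve. all: by end_near. Qed.

Lemma grid_exists (d : R) : 0 < d -> exists2 s : seq R,
  path (fun u v => [&& 0 <= u, u < v, v <= 1 & v - u < d]) 0 s & last 0 s = 1.
Proof.
move=> d0; pose N := (Num.truncn d^-1).+1.
have N0 : 0 < N%:R :> R by rewrite ltr0n.
have Nd : N%:R^-1 < d.
  by rewrite -[ltRHS]invrK ltf_pV2 ?posrE ?invr_gt0//; exact: truncnS_gt.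
suff H (k : nat) : (k <= N)%N -> exists2 s : seq R,
    path (fun u v => [&& 0 <= u, u < v, v <= 1 & v - u < d]) 0 s &
    last 0 s = k%:R / N%:R.
  by have [s ? sl] := H N (leqnn _); exists s; rewrite // sl divff// gt_eqF.
elim: k => [_|k IH kN]; first by exists [::] => //=; rewrite mul0r.
have [s ps ls] := IH (ltnW kN).
exists (rcons s (k.+1%:R / N%:R)); last by rewrite last_rcons.
rewrite rcons_path ps/= ls divr_ge0 ?ler0n//= ltr_pM2r ?invr_gt0// ltr_nat ltnSn.
rewrite ler_pdivrMr// mul1r ler_nat kN/=.
by rewrite -natr1 mulrDl mul1r addrAC subrr add0r.
Qed.

End WithinContinuity.

Section RightGroup.
Context {G : Type} (m : G -> G -> G) (o : G) (i : G -> G).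
Hypotheses (mA : associative m) (m1 : right_id o m)
  (mV : right_inverse o i m).

Lemma right_group_mulVg : left_inverse o i m.
Proof.
by move=> a; rewrite -[LHS]m1 -[in LHS](mV (i a)) mA -(mA (i a)) mV m1 mV.
Qed.

Lemma right_group_mul1g : left_id o m.
Proof. by move=> a; rewrite -[in LHS](mV a) -mA right_group_mulVg m1. Qed.

End RightGroup.

Lemma monoid_morphism_of_mul (G H : groupType) (f : G -> H) :
  {morph f : a b / (a * b)%g} -> monoid.monoid_morphism f.
Proof.
move=> fM; split => //.
by apply: (@mulgI H (f 1%g)); rewrite -fM !mulg1.
Qed.

(** The quotient groups of MathComp are restricted to finite groups. *)

Record normal_subgroup (G : groupType) := NormalSubgroup {
  nsg_set : set G;
  nsg1 : nsg_set 1%g;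
  nsgM : forall a b, nsg_set a -> nsg_set b -> nsg_set (a * b)%g;
  nsgV : forall a, nsg_set a -> nsg_set a^-1%g;
  nsgJ : forall a b, nsg_set a -> nsg_set (a ^ b)%g }.

Section QuotientGroup.
Context {G : groupType} (N : normal_subgroup G).

Definition coset_eq : rel G := fun a b => `[< nsg_set N (a^-1 * b)%g >].

Lemma coset_eq_refl : reflexive coset_eq.
Proof. by move=> a; apply/asboolP; rewrite mulVg; exact: nsg1. Qed.

Lemma coset_eq_sym : symmetric coset_eq.
Proof.
suff H a b : coset_eq a b -> coset_eq b a by move=> a b; apply/idP/idP; exact: H.
by move=> /asboolP /nsgV; rewrite invgM invgK => ?; apply/asboolP.
Qed.

Lemma coset_eq_trans : transitive coset_eq.
Proof.
move=> b a c /asboolP ab /asboolP bc; apply/asboolP.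
by have := nsgM ab bc; rewrite mulgA mulgK.
Qed.

Canonical coset_equiv :=
  EquivRel coset_eq coset_eq_refl coset_eq_sym coset_eq_trans.

Definition quotient_group := {eq_quot coset_equiv}%qT.
HB.instance Definition _ := Choice.on quotient_group.

Definition lcoset_of (a : G) : quotient_group := (\pi_{eq_quot coset_equiv} a)%qT.

Lemma lcoset_ofP a b : lcoset_of a = lcoset_of b <-> nsg_set N (a^-1 * b)%g.
Proof.
split; first by move=> /eqmodP /asboolP.
by move=> Nab; apply/eqmodP/asboolP.
Qed.

Lemma lcoset_of_repr (a : quotient_group) : lcoset_of (repr a) = a.
Proof. exact: reprK. Qed.

Definition quotient_mul (a b : quotient_group) : quotient_group :=
  lcoset_of (repr a * repr b)%g.
Definition quotient_one : quotient_group := lcoset_of 1%g.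
Definition quotient_inv (a : quotient_group) : quotient_group :=
  lcoset_of (repr a)^-1%g.

Lemma quotient_mulE a b : quotient_mul (lcoset_of a) (lcoset_of b) = lcoset_of (a * b)%g.
Proof.
have /lcoset_ofP Na := lcoset_of_repr (lcoset_of a).
have /lcoset_ofP Nb := lcoset_of_repr (lcoset_of b).
apply/lcoset_ofP; have := nsgM Nb (nsgJ b Na).
by rewrite conjgE !mulgA mulgK invgM ?mulgA.
Qed.

Lemma quotient_invE a : quotient_inv (lcoset_of a) = lcoset_of a^-1%g.
Proof.
have /lcoset_ofP Na := lcoset_of_repr (lcoset_of a).
apply/lcoset_ofP; have := nsgJ a^-1%g (nsgV Na).
by rewrite conjgE !invgM !invgK !mulgA mulgV mul1g.
Qed.

Fact quotient_mulA : associative quotient_mul.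
Proof.
move=> a b c; rewrite -(lcoset_of_repr a) -(lcoset_of_repr b) -(lcoset_of_repr c).
by rewrite !quotient_mulE mulgA.
Qed.

Fact quotient_mulg1 : right_id quotient_one quotient_mul.
Proof. by move=> a; rewrite -(lcoset_of_repr a) quotient_mulE mulg1. Qed.

Fact quotient_mulgV : right_inverse quotient_one quotient_inv quotient_mul.
Proof.
by move=> a; rewrite -(lcoset_of_repr a) quotient_invE quotient_mulE mulgV.
Qed.

HB.instance Definition _ := isGroup.Build quotient_group
  quotient_mulA (right_group_mul1g quotient_mulA quotient_mulg1 quotient_mulgV)
  quotient_mulg1
  (right_group_mulVg quotient_mulA quotient_mulg1 quotient_mulgV)
  quotient_mulgV.

Fact lcoset_of_monoid_morphism : monoid.monoid_morphism lcoset_of.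
Proof. by apply: monoid_morphism_of_mul => a b; rewrite -quotient_mulE. Qed.

HB.instance Definition _ :=
  isUMagmaMorphism.Build G quotient_group lcoset_of lcoset_of_monoid_morphism.

End QuotientGroup.

Section Chains.
Context {R : realType} {X : metricType R}.
Implicit Types (e : R) (x y z : X) (s t : seq X).

(** As in [path], the sequence [s] stands for the chain [x :: s], so that the
    starting point [x] is a parameter. *)
Definition echain e x y s : bool :=
  path (fun u v => mdist u v < e) x s && (last x s == y).

Definition adds_point s t :=
  exists s1 z s2, s = s1 ++ s2 /\ t = s1 ++ z :: s2.

(** The first point is untouched, and the last one is kept by [echain]; adding
    a copy of [y] after the last point is the same as adding it just before. *)
Definition basic_move e x y s t :=
  [/\ echain e x y s, echain e x y t & adds_point s t \/ adds_point t s].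

Inductive ehomotopic e x y s : seq X -> Prop :=
| ehomotopic_refl : ehomotopic e x y s s
| ehomotopic_move t u :
    ehomotopic e x y s t -> basic_move e x y t u -> ehomotopic e x y s u.

Lemma ehomotopic_trans e x y t s u :
  ehomotopic e x y s t -> ehomotopic e x y t u -> ehomotopic e x y s u.
Proof. by move=> st; elim => // ? ? _; exact: ehomotopic_move. Qed.

Lemma basic_move_sym e x y s t : basic_move e x y s t -> basic_move e x y t s.
Proof. by move=> [? ? [?|?]]; split => //; [right|left]. Qed.

Lemma basic_move_ehomotopic e x y s t :
  basic_move e x y s t -> ehomotopic e x y s t.
Proof. by apply: ehomotopic_move; exact: ehomotopic_refl. Qed.

Lemma ehomotopic_sym e x y s t : ehomotopic e x y s t -> ehomotopic e x y t s.
Proof.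
elim => [|? ? _ IH /basic_move_sym /basic_move_ehomotopic tu].
  exact: ehomotopic_refl.
exact: ehomotopic_trans tu IH.
Qed.

Lemma ehomotopic_cat e x y z s1 s2 t1 t2 :
  echain e x y s1 -> echain e y z s2 ->
  ehomotopic e x y s1 t1 -> ehomotopic e y z s2 t2 ->
  ehomotopic e x z (s1 ++ s2) (t1 ++ t2).
Proof.
move=> cs1 cs2 st1.
have catc u v : echain e x y u -> echain e y z v -> echain e x z (u ++ v).
  move=> /andP[pu /eqP lu] /andP[pv lv].
  by rewrite /echain cat_path pu last_cat lu pv.
have ct1 : echain e x y t1 by case: st1 => // ? ? _ [].
move=> st2; apply: (@ehomotopic_trans _ _ _ (t1 ++ s2)).
  elim: st1 {ct1} => [|t u _ IH [ct cu tu]]; first exact: ehomotopic_refl.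
  apply: ehomotopic_move IH _; split; [exact: catc..|].
  by case: tu => -[p [w [q [-> ->]]]]; [left|right]; exists p, w, (q ++ s2);
    rewrite -!catA.
elim: st2 => [|t u _ IH [ct cu tu]]; first exact: ehomotopic_refl.
apply: ehomotopic_move IH _; split; [exact: catc..|].
by case: tu => -[p [w [q [-> ->]]]]; [left|right]; exists (t1 ++ p), w, q;
  rewrite -!catA.
Qed.

Lemma echain1 e x y : echain e x y [:: y] = (mdist x y < e).
Proof. by rewrite /echain /= eqxx !andbT. Qed.

Lemma echain_cons e x y z s :
  echain e x y (z :: s) = (mdist x z < e) && echain e z y s.
Proof. by rewrite /echain /= andbA. Qed.

Lemma ehomotopic_cons e x y z s t : mdist x z < e -> echain e z y s ->
  ehomotopic e z y s t -> ehomotopic e x y (z :: s) (z :: t).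
Proof.
move=> xz cs st; rewrite -[z :: s]cat1s -[z :: t]cat1s.
by apply: (ehomotopic_cat (y := z)) => //; rewrite ?echain1//; exact: ehomotopic_refl.
Qed.

Lemma ehomotopic_add e x y z s : mdist x z < e -> echain e z y s ->
  echain e x y s -> ehomotopic e x y s (z :: s).
Proof.
move=> xz cz cs; apply: basic_move_ehomotopic; split => //.
  by rewrite echain_cons xz.
by left; exists [::], z, s.
Qed.

Lemma ehomotopic_ends e x y s t :
  echain e x y s -> ehomotopic e x y s t -> echain e x y t.
Proof. by move=> cs [//|? ? _ []]. Qed.

End Chains.

Section ChainGroup.
Context {R : realType} {X : metricType R} (e : R) (x : X).

Definition eloop := {s : seq X | echain e x x s}.

Implicit Types a b c : eloop.

Definition eloop_eq : rel eloop :=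
  fun a b => `[< ehomotopic e x x (val a) (val b) >].

Lemma eloop_eq_refl : reflexive eloop_eq.
Proof. by move=> a; apply/asboolP; exact: ehomotopic_refl. Qed.

Lemma eloop_eq_sym : symmetric eloop_eq.
Proof.
by move=> a b; apply/idP/idP => /asboolP/ehomotopic_sym ?; apply/asboolP.
Qed.

Lemma eloop_eq_trans : transitive eloop_eq.
Proof.
move=> b a c /asboolP ab /asboolP bc; apply/asboolP.
exact: ehomotopic_trans ab bc.
Qed.

Canonical eloop_equiv :=
  EquivRel eloop_eq eloop_eq_refl eloop_eq_sym eloop_eq_trans.

Definition pi_eps := {eq_quot eloop_equiv}%qT.
HB.instance Definition _ := Choice.on pi_eps.

Definition eloop_class a : pi_eps := (\pi_{eq_quot eloop_equiv} a)%qT.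

Lemma eloop_classP a b :
  eloop_class a = eloop_class b <-> ehomotopic e x x (val a) (val b).
Proof.
split; first by move=> /eqmodP /asboolP.
by move=> ab; apply/eqmodP/asboolP.
Qed.

Lemma eloop_class_repr (u : pi_eps) : eloop_class (repr u) = u.
Proof. exact: reprK. Qed.

(** The chains [x :: s] and [x :: t] share the point [x] at which they are
    concatenated. *)
Fact eloop_cat_subproof a b : echain e x x (val a ++ val b).
Proof.
case: a b => [s /= /andP[ps /eqP ls]] [t /= /andP[pt lt]].
by rewrite /echain cat_path ps last_cat ls pt.
Qed.
Definition eloop_cat a b : eloop := Sub (val a ++ val b) (eloop_cat_subproof a b).

Fact eloop_cst_subproof : echain e x x [::].
Proof. by rewrite /echain /= eqxx. Qed.
Definition eloop_cst : eloop := Sub [::] eloop_cst_subproof.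

(** The reverse of [x :: s] is [x :: rev (belast x s)] since [s] ends at [x]. *)
Fact eloop_rev_subproof a : echain e x x (rev (belast x (val a))).
Proof.
case: a => [s /= /andP[ps /eqP ls]]; rewrite /echain -{1}ls rev_path.
rewrite (@eq_path _ _ (fun u v => mdist u v < e)) ?ps/=; last first.
  by move=> u v; rewrite metric_sym.
by case: s {ps} ls => //= u s _; rewrite rev_cons last_rcons.
Qed.
Definition eloop_rev a : eloop :=
  Sub (rev (belast x (val a))) (eloop_rev_subproof a).

Definition pi_eps_mul (u v : pi_eps) : pi_eps :=
  eloop_class (eloop_cat (repr u) (repr v)).
Definition pi_eps_one : pi_eps := eloop_class eloop_cst.
Definition pi_eps_inv (u : pi_eps) : pi_eps := eloop_class (eloop_rev (repr u)).

Lemma pi_eps_mulE a b :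
  pi_eps_mul (eloop_class a) (eloop_class b) = eloop_class (eloop_cat a b).
Proof.
have /eloop_classP ha := eloop_class_repr (eloop_class a).
have /eloop_classP hb := eloop_class_repr (eloop_class b).
by apply/eloop_classP; apply: ehomotopic_cat ha hb; exact: valP.
Qed.

Fact pi_eps_mulA : associative pi_eps_mul.
Proof.
move=> u v w; rewrite -(eloop_class_repr u) -(eloop_class_repr v).
rewrite -(eloop_class_repr w) !pi_eps_mulE; congr eloop_class.
by apply: val_inj; rewrite /= catA.
Qed.

Fact pi_eps_mulg1 : right_id pi_eps_one pi_eps_mul.
Proof.
move=> u; rewrite -(eloop_class_repr u) pi_eps_mulE; congr eloop_class.
by apply: val_inj; rewrite /= cats0.
Qed.

Fact pi_eps_mulgV : right_inverse pi_eps_one pi_eps_inv pi_eps_mul.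
Proof.
move=> u; rewrite -{1}(eloop_class_repr u) pi_eps_mulE.
apply/eloop_classP => /=; case: (repr u) => [s /= /andP[ps _]].
suff : forall z, path (fun u v => mdist u v < e) z s ->
  echain e z z (s ++ rev (belast z s)) /\
  ehomotopic e z z (s ++ rev (belast z s)) [::] by move=> /(_ _ ps)[].
elim: s {ps} => [z _|w s IH z /= /andP[zw ps]].
  by split; [rewrite /echain /= eqxx|exact: ehomotopic_refl].
have [cw hw] := IH _ ps.
have wz : mdist w z < e by rewrite metric_sym.
have e0 : 0 < e := le_lt_trans (mdist_ge0 _ _) zw.
rewrite rev_cons -cats1 catA.
have c1 : echain e w z [:: z] by rewrite echain1.
have h1 : ehomotopic e w z ((s ++ rev (belast w s)) ++ [:: z]) [:: z].
  by rewrite -[X in ehomotopic _ _ _ _ X]cat0s;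
    apply: ehomotopic_cat cw c1 hw (ehomotopic_refl _ _ _ _).
have c2 : echain e w z ((s ++ rev (belast w s)) ++ [:: z]).
  by apply: ehomotopic_ends (ehomotopic_sym h1).
have c3 : echain e z z [:: z] by rewrite echain1 mdistxx.
split; first by rewrite echain_cons zw.
apply: ehomotopic_trans (ehomotopic_cons zw c2 h1) _.
apply: ehomotopic_sym; apply: (@ehomotopic_trans _ _ _ _ _ [:: z]).
  by apply: ehomotopic_add; rewrite ?mdistxx// /echain /= eqxx.
exact: ehomotopic_add.
Qed.

HB.instance Definition _ := isGroup.Build pi_eps
  pi_eps_mulA (right_group_mul1g pi_eps_mulA pi_eps_mulg1 pi_eps_mulgV)
  pi_eps_mulg1 (right_group_mulVg pi_eps_mulA pi_eps_mulg1 pi_eps_mulgV)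
  pi_eps_mulgV.

End ChainGroup.

Section UnitInterval.
Context {R : realType}.

Lemma unit_itvP (t : R) : `[0, 1]%classic t <-> 0 <= t <= 1.
Proof. by rewrite /= in_itv. Qed.

Lemma continuous_minr (T : topologicalType) (f g : T -> R) :
  continuous f -> continuous g -> continuous (fun t => Num.min (f t) (g t)).
Proof. by move=> cf cg t; exact: (continuous_min (cf t) (cg t)). Qed.

Lemma continuous_affine (a b : R) : continuous (fun t : R => a * t + b).
Proof.
move=> t; apply: cvgD; last exact: cvg_cst.
by apply: cvgM; [exact: cvg_cst|exact: cvg_id].
Qed.

Lemma continuous_pair (T U V : topologicalType) (f : T -> U) (g : T -> V) :
  continuous f -> continuous g -> continuous (fun t => (f t, g t)).
Proof. by move=> cf cg t; exact: (cvg_pair (cf t) (cg t)). Qed.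

End UnitInterval.

Section Loops.
Context {R : realType} {X : metricType R}.

(** Loops are functions on [R] of which only the restriction to [`[0, 1]]
    matters: two loops with the same restriction are homotopic. *)
Record loop (x : X) := Loop {
  loop_fun :> R -> X;
  loop_continuous : {within `[0, 1], continuous loop_fun};
  loop0 : loop_fun 0 = x;
  loop1 : loop_fun 1 = x }.
Arguments loop_continuous {x} l.

HB.instance Definition _ x := gen_eqMixin (loop x).
HB.instance Definition _ x := gen_choiceMixin (loop x).

Definition unit_square : set (R * R) := `[0, 1] `*` `[0, 1].

Definition loop_homotopic (x : X) (p q : loop x) := exists H : R * R -> X,
  [/\ {within unit_square, continuous H},
      forall t : R, 0 <= t <= 1 -> H (t, 0) = p t /\ H (t, 1) = q t &
      forall s : R, 0 <= s <= 1 -> H (0, s) = x /\ H (1, s) = x].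

Lemma unit_square_closed : closed unit_square.
Proof.
apply: compact_closed; first exact: pseudometric_normed_Zmodule.norm_hausdorff.
by apply: compact_setX; exact: segment_compact.
Qed.

(** Two reparametrisations of the same path [g] with the same endpoints are
    homotopic, by straight-line interpolation of the parameters. *)
Lemma loop_reparam (x : X) (p q : loop x) (g : R -> X) (phi psi : R -> R) :
  {within `[0, 1], continuous g} -> continuous phi -> continuous psi ->
  (forall t : R, 0 <= t <= 1 -> 0 <= phi t <= 1 /\ 0 <= psi t <= 1) ->
  phi 0 = psi 0 -> phi 1 = psi 1 ->
  (forall t : R, 0 <= t <= 1 -> p t = g (phi t) /\ q t = g (psi t)) ->
  loop_homotopic p q.
Proof.
move=> cg cphi cpsi H01 e0 e1 pq.
pose L (z : R * R) : R := (1 - z.2) * phi z.1 + z.2 * psi z.1.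
have cL : continuous L.
  move=> z; apply: cvgD; apply: cvgM.
  - by apply: cvgB; [exact: cvg_cst|exact: cvg_snd].
  - by apply: continuous_comp; [exact: cvg_fst|exact: cphi].
  - exact: cvg_snd.
  - by apply: continuous_comp; [exact: cvg_fst|exact: cpsi].
exists (g \o L); split.
- apply: within_comp cg _; first exact: continuous_subspaceT.
  move=> [t s] /= [/=]; rewrite !in_itv/= => t01 s01.
  have [phit psit] := H01 _ t01; rewrite /L/=; nra.
- move=> t t01; have [-> ->] := pq _ t01; rewrite /L /=.
  by rewrite subr0 subrr !mul0r !mul1r addr0 add0r.
- have z01 : 0 <= (0 : R) <= 1 by rewrite lexx ler01.
  have o01 : 0 <= (1 : R) <= 1 by rewrite lexx ler01.
  move=> s s01; rewrite /L /= e0 e1 -!mulrDl subrK !mul1r.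
  by rewrite -(pq _ z01).2 -(pq _ o01).2 loop0 loop1.
Qed.

Lemma eq_loop_homotopic (x : X) (p q : loop x) :
  (forall t : R, 0 <= t <= 1 -> p t = q t) -> loop_homotopic p q.
Proof.
move=> pq; apply: (@loop_reparam _ _ _ p id id) => //.
- exact: loop_continuous.
- by move=> t; exact: cvg_id.
- by move=> t; exact: cvg_id.
- by move=> t /pq ->.
Qed.

Lemma loop_homotopic_sym (x : X) (p q : loop x) :
  loop_homotopic p q -> loop_homotopic q p.
Proof.
move=> [H [cH Hpq Hx]]; exists (H \o (fun z => (z.1, 1 - z.2))); split.
- apply: within_comp cH _.
    apply: continuous_subspaceT; apply: continuous_pair => z; first exact: cvg_fst.
    by apply: cvgB; [exact: cvg_cst|exact: cvg_snd].
  by move=> [t s] /= [/=]; rewrite !in_itv/= => ? ?; split => /=; rewrite in_itv/=; lra.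
- by move=> t /Hpq[/= H0 H1]; rewrite subr0 subrr.
- by move=> s s01 /=; apply: Hx; lra.
Qed.

Lemma square_paste (c : R * R -> R) (f g h : R * R -> X) :
  continuous c ->
  {within unit_square `&` [set z | c z <= 2^-1], continuous f} ->
  {within unit_square `&` [set z | 2^-1 <= c z], continuous g} ->
  (forall z, unit_square z -> c z <= 2^-1 -> f z = h z) ->
  (forall z, unit_square z -> 2^-1 <= c z -> g z = h z) ->
  {within unit_square, continuous h}.
Proof.
move=> cc cf cg fh gh; apply: (within_paste _ _ cf cg).
- apply: closedI; first exact: unit_square_closed.
  by apply: (@closed_comp _ _ c [set r | r <= 2^-1]) => //; exact: closed_le.
- apply: closedI; first exact: unit_square_closed.
  by apply: (@closed_comp _ _ c [set r | 2^-1 <= r]) => //; exact: closed_ge.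
- by move=> z /set_mem[/= ? ?]; exact: fh.
- by move=> z /set_mem[/= ? ?]; exact: gh.
- by move=> z sz; case: (leP (c z) 2^-1) => [|/ltW] ?; [left|right].
Qed.

Lemma loop_homotopic_trans (x : X) (p q r : loop x) :
  loop_homotopic p q -> loop_homotopic q r -> loop_homotopic p r.
Proof.
move=> [H [cH Hpq Hx]] [K [cK Kqr Kx]].
exists (fun z => if z.2 <= 2^-1 then H (z.1, 2 * z.2) else K (z.1, 2 * z.2 - 1)).
split.
- apply: (@square_paste snd (H \o (fun z => (z.1, 2 * z.2)))
                        (K \o (fun z => (z.1, 2 * z.2 - 1)))).
  + by move=> z; exact: cvg_snd.
  + apply: within_comp cH _.
      apply: continuous_subspaceT; apply: continuous_pair => z; first exact: cvg_fst.
      by apply: cvgM; [exact: cvg_cst|exact: cvg_snd].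
    move=> [t s] /= [[/=]]; rewrite !in_itv/= => ? ? ?.
    by split => /=; rewrite in_itv/=; lra.
  + apply: within_comp cK _.
      apply: continuous_subspaceT; apply: continuous_pair => z; first exact: cvg_fst.
      apply: cvgB; last exact: cvg_cst.
      by apply: cvgM; [exact: cvg_cst|exact: cvg_snd].
    move=> [t s] /= [[/=]]; rewrite !in_itv/= => ? ? ?.
    by split => /=; rewrite in_itv/=; lra.
  + by move=> z _ /= ->.
  + move=> [t s] /= [/=]; rewrite !in_itv/= => t01 _ s2.
    case: ifPn => // s2'; have -> : s = 2^-1 by lra.
    by rewrite divff// subrr (Hpq _ t01).2 (Kqr _ t01).1.
- move=> t t01; rewrite /= mulr0 invr_ge0 ler0n (Hpq _ t01).1; split => //.
  rewrite ifF; last by apply/negbTE; lra.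
  by rewrite mulr1 (_ : 2 - 1 = 1) ?(Kqr _ t01).2//; lra.
- by move=> s s01 /=; case: ifPn => ?; [apply: Hx|apply: Kx]; lra.
Qed.

Definition loop_mul_fun (x : X) (p q : loop x) (t : R) : X :=
  if t <= 2^-1 then p (2 * t) else q (2 * t - 1).

Lemma loop_mul_continuous (x : X) (p q : loop x) :
  {within `[0, 1], continuous (loop_mul_fun p q)}.
Proof.
apply: (@within_paste R X `[0, 2^-1]%classic `[2^-1, 1]%classic _
  (p \o (fun t : R => 2 * t + 0)) (q \o (fun t : R => 2 * t + -1)) (loop_mul_fun p q)).
- exact: itv_closed.
- exact: itv_closed.
- apply: within_comp (loop_continuous p) _.
    by apply: continuous_subspaceT; exact: continuous_affine.
  by move=> t /=; rewrite !in_itv/= => ?; lra.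
- apply: within_comp (loop_continuous q) _.
    by apply: continuous_subspaceT; exact: continuous_affine.
  by move=> t /=; rewrite !in_itv/= => ?; lra.
- by move=> t /set_mem /=; rewrite in_itv/= /loop_mul_fun addr0 => /andP[_ ->].
- move=> t /set_mem /=; rewrite in_itv/= /loop_mul_fun => /andP[t2 _].
  case: ifPn => // t2'; have -> : t = 2^-1 by lra.
  by rewrite divff// subrr loop0 loop1.
- move=> t /=; rewrite !in_itv/= => t01.
  by case: (leP t 2^-1) => ?; [left|right]; rewrite /= ?in_itv/=; lra.
Qed.
Arguments loop_mul_continuous {x} p q.

Fact loop_mul0 (x : X) (p q : loop x) : loop_mul_fun p q 0 = x.
Proof. by rewrite /loop_mul_fun invr_ge0 ler0n mulr0 loop0. Qed.

Fact loop_mul1 (x : X) (p q : loop x) : loop_mul_fun p q 1 = x.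
Proof.
rewrite /loop_mul_fun ifF; last by apply/negbTE; lra.
by rewrite mulr1 (_ : 2 - 1 = 1) ?loop1//; lra.
Qed.

Definition loop_mul (x : X) (p q : loop x) : loop x :=
  Loop (loop_mul_continuous p q) (loop_mul0 p q) (loop_mul1 p q).

Definition loop_cst (x : X) : loop x :=
  @Loop x (cst x) (continuous_subspaceT (@cst_continuous _ _ x)) erefl erefl.

Lemma loop_inv_continuous (x : X) (p : loop x) :
  {within `[0, 1], continuous (fun t => p (1 - t))}.
Proof.
apply: (@within_comp R R X _ `[0, 1]%classic (fun t : R => 1 - t) p).
- apply: continuous_subspaceT => t.
  by apply: cvgB; [exact: cvg_cst|exact: cvg_id].
- exact: loop_continuous.
- by move=> t /=; rewrite !in_itv/= => ?; lra.
Qed.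
Arguments loop_inv_continuous {x} p.

Fact loop_inv0 (x : X) (p : loop x) : p (1 - 0) = x.
Proof. by rewrite subr0 loop1. Qed.

Fact loop_inv1 (x : X) (p : loop x) : p (1 - 1) = x.
Proof. by rewrite subrr loop0. Qed.

Definition loop_inv (x : X) (p : loop x) : loop x :=
  Loop (loop_inv_continuous p) (loop_inv0 p) (loop_inv1 p).

Lemma loop_mul_homotopic (x : X) (p p' q q' : loop x) :
  loop_homotopic p p' -> loop_homotopic q q' ->
  loop_homotopic (loop_mul p q) (loop_mul p' q').
Proof.
move=> [H [cH Hpp Hx]] [K [cK Kqq Kx]].
exists (fun z => if z.1 <= 2^-1 then H (2 * z.1, z.2) else K (2 * z.1 - 1, z.2)).
split.
- apply: (@square_paste fst (H \o (fun z => (2 * z.1, z.2)))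
                        (K \o (fun z => (2 * z.1 - 1, z.2)))).
  + by move=> z; exact: cvg_fst.
  + apply: within_comp cH _.
      apply: continuous_subspaceT; apply: continuous_pair => z; last exact: cvg_snd.
      by apply: cvgM; [exact: cvg_cst|exact: cvg_fst].
    move=> [t s] /= [[/=]]; rewrite !in_itv/= => ? ? ?.
    by split => /=; rewrite in_itv/=; lra.
  + apply: within_comp cK _.
      apply: continuous_subspaceT; apply: continuous_pair => z; last exact: cvg_snd.
      apply: cvgB; last exact: cvg_cst.
      by apply: cvgM; [exact: cvg_cst|exact: cvg_fst].
    move=> [t s] /= [[/=]]; rewrite !in_itv/= => ? ? ?.
    by split => /=; rewrite in_itv/=; lra.
  + by move=> z _ /= ->.
  + move=> [t s] /= [/=]; rewrite !in_itv/= => _ s01 t2.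
    case: ifPn => // t2'; have -> : t = 2^-1 by lra.
    by rewrite divff// subrr (Hx _ s01).2 (Kx _ s01).1.
- move=> t t01; rewrite /= /loop_mul_fun; case: ifPn => ?; [apply: Hpp|apply: Kqq]; lra.
- move=> s s01 /=; rewrite mulr0 invr_ge0 ler0n (Hx _ s01).1; split => //.
  rewrite ifF; last by apply/negbTE; lra.
  by rewrite mulr1 (_ : 2 - 1 = 1) ?(Kx _ s01).2//; lra.
Qed.

Lemma loop_mulA (x : X) (p q r : loop x) :
  loop_homotopic (loop_mul p (loop_mul q r)) (loop_mul (loop_mul p q) r).
Proof.
apply: (@loop_reparam _ _ _ (loop_mul p (loop_mul q r)) id
  (fun t => Num.min (2 * t + 0) (Num.min (1 * t + 4^-1) (2^-1 * t + 2^-1)))).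
- exact: loop_continuous.
- by move=> t; exact: cvg_id.
- by do 2?apply: continuous_minr; exact: continuous_affine.
- move=> t t01; split => //; rewrite /Num.min.
  by case: ifPn; case: ifPn; lra.
- by rewrite /Num.min; case: ifPn; case: ifPn; lra.
- by rewrite /Num.min; case: ifPn; case: ifPn; lra.
- move=> t t01; split => //=; rewrite /loop_mul_fun /= /loop_mul_fun.
  have [t4|t4] := leP t 4^-1.
    rewrite [Num.min _ _](_ : _ = 2 * t); last first.
      by rewrite /Num.min; case: ifPn; case: ifPn; lra.
    by rewrite !ifT//; lra.
  have [t2|t2] := leP t 2^-1.
    rewrite [Num.min _ _](_ : _ = t + 4^-1); last first.
      by rewrite /Num.min; case: ifPn; case: ifPn; lra.
    rewrite ifF; last by apply/negbTE; lra.
    rewrite ifF; last by apply/negbTE; lra.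
    by rewrite ifT; [congr (q _)|]; lra.
  rewrite [Num.min _ _](_ : _ = 2^-1 * t + 2^-1); last first.
    by rewrite /Num.min; case: ifPn; case: ifPn; lra.
  rewrite ifF; last by apply/negbTE; lra.
  rewrite ifF; last by apply/negbTE; lra.
  by congr (r _); lra.
Qed.

Lemma loop_mul_cst (x : X) (p : loop x) :
  loop_homotopic (loop_mul p (loop_cst x)) p.
Proof.
apply: (@loop_reparam _ _ _ p (fun t => Num.min (2 * t + 0) (0 * t + 1)) id).
- exact: loop_continuous.
- by apply: continuous_minr; exact: continuous_affine.
- by move=> t; exact: cvg_id.
- by move=> t t01; split => //; rewrite /Num.min; case: ifPn; lra.
- by rewrite /Num.min; case: ifPn; lra.
- by rewrite /Num.min; case: ifPn; lra.
- move=> t t01; split => //=; rewrite /loop_mul_fun; case: ifPn => t2 /=.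
    by congr (p _); rewrite /Num.min; case: ifPn; lra.
  rewrite -[in LHS](loop1 p); congr (p _).
  by rewrite /Num.min; case: ifPn; lra.
Qed.

Lemma loop_mul_inv (x : X) (p : loop x) :
  loop_homotopic (loop_mul p (loop_inv p)) (loop_cst x).
Proof.
apply: (@loop_reparam _ _ _ p (fun t => Num.min (2 * t + 0) (- 2 * t + 2))
                              (fun t => 0 * t + 0)).
- exact: loop_continuous.
- by apply: continuous_minr; exact: continuous_affine.
- exact: continuous_affine.
- by move=> t t01; split; rewrite /Num.min; [case: ifPn|]; lra.
- by rewrite /Num.min; case: ifPn; lra.
- by rewrite /Num.min; case: ifPn; lra.
- move=> t t01; split => /=; last by rewrite mul0r addr0 loop0.
  rewrite /loop_mul_fun; by case: ifPn => t2; congr (p _); rewrite /Num.min; case: ifPn; lra.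
Qed.

End Loops.

Arguments loop_continuous {R X x} l.

Section FundamentalGroup.
Context {R : realType} {X : metricType R} (x : X).
Implicit Types p q : loop x.

Definition loop_eq : rel (loop x) := fun p q => `[< loop_homotopic p q >].

Lemma loop_eq_refl : reflexive loop_eq.
Proof. by move=> p; apply/asboolP; exact: eq_loop_homotopic. Qed.

Lemma loop_eq_sym : symmetric loop_eq.
Proof.
by move=> p q; apply/idP/idP => /asboolP/loop_homotopic_sym ?; apply/asboolP.
Qed.

Lemma loop_eq_trans : transitive loop_eq.
Proof.
move=> q p r /asboolP pq /asboolP qr; apply/asboolP.
exact: loop_homotopic_trans pq qr.
Qed.

Canonical loop_equiv := EquivRel loop_eq loop_eq_refl loop_eq_sym loop_eq_trans.

Definition pi1 := {eq_quot loop_equiv}%qT.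
HB.instance Definition _ := Choice.on pi1.

Definition loop_class p : pi1 := (\pi_{eq_quot loop_equiv} p)%qT.

Lemma loop_classP p q : loop_class p = loop_class q <-> loop_homotopic p q.
Proof.
split; first by move=> /eqmodP /asboolP.
by move=> pq; apply/eqmodP/asboolP.
Qed.

Lemma loop_class_repr (u : pi1) : loop_class (repr u) = u.
Proof. exact: reprK. Qed.

Definition pi1_mul (u v : pi1) : pi1 := loop_class (loop_mul (repr u) (repr v)).
Definition pi1_one : pi1 := loop_class (loop_cst x).
Definition pi1_inv (u : pi1) : pi1 := loop_class (loop_inv (repr u)).

Lemma pi1_mulE p q :
  pi1_mul (loop_class p) (loop_class q) = loop_class (loop_mul p q).
Proof.
have /loop_classP hp := loop_class_repr (loop_class p).
have /loop_classP hq := loop_class_repr (loop_class q).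
by apply/loop_classP; exact: loop_mul_homotopic.
Qed.

Fact pi1_mulA : associative pi1_mul.
Proof.
move=> u v w; rewrite -(loop_class_repr u) -(loop_class_repr v).
rewrite -(loop_class_repr w) !pi1_mulE; apply/loop_classP; exact: loop_mulA.
Qed.

Fact pi1_mulg1 : right_id pi1_one pi1_mul.
Proof.
move=> u; rewrite -(loop_class_repr u) pi1_mulE.
by apply/loop_classP; exact: loop_mul_cst.
Qed.

Fact pi1_mulgV : right_inverse pi1_one pi1_inv pi1_mul.
Proof.
move=> u; rewrite -{1}(loop_class_repr u) pi1_mulE.
by apply/loop_classP; exact: loop_mul_inv.
Qed.

HB.instance Definition _ := isGroup.Build pi1
  pi1_mulA (right_group_mul1g pi1_mulA pi1_mulg1 pi1_mulgV)
  pi1_mulg1 (right_group_mulVg pi1_mulA pi1_mulg1 pi1_mulgV) pi1_mulgV.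

End FundamentalGroup.

Section StrongChains.
Context {R : realType} {X : metricType R}.
Implicit Types (e : R) (g : R -> X) (a b : R) (s t : seq R).

(** With [t_0 = a] and [s = [:: t_1; ...; t_n]], the chain
    [g t_0, ..., g t_n] is represented by the sequence [map g s]. *)
Definition strong_partition e g a b s :=
  itv_partition a b s /\
  forall i, (i < size s)%N ->
    let u := nth b (a :: s) i in let v := nth b (a :: s) i.+1 in
    g @` `[u, v] `<=` ball (g u) e `&` ball (g v) e.

Definition strong_step e g : rel R := fun u v => (u < v) &&
  `[< forall r, u <= r <= v -> mdist (g u) (g r) < e /\ mdist (g v) (g r) < e >].

Lemma strong_partitionP e g a b s :
  strong_partition e g a b s <-> path (strong_step e g) a s /\ last a s = b.
Proof.
split=> [[[ps /eqP ls] H]|[ps ls]].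
  split=> //; apply/(pathP b) => i si; apply/andP; split.
    exact: (pathP b ps).
  apply/asboolP => r uvr; have := H _ si (g r); rewrite /= !ballEmdist.
  by apply; exists r => //=; rewrite in_itv.
split; first by split; [apply: sub_path ps => u v /andP[]|rewrite ls].
move=> i si /= _ [r + <-]; rewrite /= in_itv/= => uvr.
have /andP[_ /asboolP/(_ _ uvr)[]] := pathP b ps _ si.
by rewrite !ballEmdist.
Qed.

Lemma strong_partition_echain e g a b s : 0 < e ->
  strong_partition e g a b s -> echain e (g a) (g b) (map g s).
Proof.
move=> e0 /strong_partitionP[ps <-]; rewrite /echain last_map eqxx andbT.
rewrite path_map; apply: sub_path ps => u v /andP[uv /asboolP/(_ v)[]//].
by rewrite lexx ltW.
Qed.

Lemma strong_partition_cat e g a b c s t :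
  strong_partition e g a b s -> strong_partition e g b c t ->
  strong_partition e g a c (s ++ t).
Proof.
move=> /strong_partitionP[ps ls] /strong_partitionP[pt lt].
by apply/strong_partitionP; rewrite cat_path ps last_cat ls.
Qed.

Lemma strong_partition_affine e g (h : R -> X) a b (k c : R) s : 0 < k ->
  (forall r, a <= r <= b -> h (k * r + c) = g r) ->
  strong_partition e g a b s ->
  strong_partition e h (k * a + c) (k * b + c) (map (fun r => k * r + c) s) /\
  map h (map (fun r => k * r + c) s) = map g s.
Proof.
move=> k0 + /strong_partitionP[ps ls].
elim: s a ps ls => [a _ <- _|v s IH a /= /andP[/andP[av /asboolP Hav] ps] ls hg].
  by split=> //; apply/strong_partitionP.
have vb : v <= b.
  rewrite -ls; apply: (@itv_partition_le _ _ v _ s); split=> //.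
  by apply: sub_path ps => ? ? /andP[].
have [|/strong_partitionP[ps' ls'] ->] := IH v ps ls.
  by move=> r /andP[vr rb]; apply: hg; rewrite rb andbT (le_trans (ltW av)).
split; last by rewrite hg// (ltW av).
apply/strong_partitionP; split => //=; rewrite ps' andbT.
apply/andP; split; first by rewrite ltrD2r ltr_pM2l.
apply/asboolP => r /andP[r1 r2].
have Er : r = k * ((r - c) / k) + c by rewrite mulrCA divff ?gt_eqF// mulr1 subrK.
have r1' : a <= (r - c) / k by rewrite ler_pdivlMr// lerBrDr mulrC.
have r2' : (r - c) / k <= v by rewrite ler_pdivrMr// lerBlDr mulrC.
rewrite Er !hg ?lexx ?(ltW av)//; last 2 first.
- by rewrite r1' (le_trans r2').
- by rewrite (le_trans (ltW av)).
by apply: Hav; rewrite r1'.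
Qed.

(** Two strong chains along the same path are homotopic. *)
Lemma strong_chain_unique e g a b s t : 0 < e ->
  strong_partition e g a b s -> strong_partition e g a b t ->
  ehomotopic e (g a) (g b) (map g s) (map g t).
Proof.
move=> e0 /strong_partitionP[ps ls] /strong_partitionP[pt lt].
pose step : rel R := fun u v => (u < v) &&
  `[< forall r, u <= r <= v -> mdist (g r) (g v) < e >].
have steps u w : path (strong_step e g) u w -> path step u w.
  apply: sub_path => y z /andP[yz /asboolP H]; rewrite /step yz/=.
  by apply/asboolP => r /H[_]; rewrite metric_sym.
move: ps pt => /steps ps /steps pt {steps}.
have chn u w : path step u w -> echain e (g u) (g (last u w)) (map g w).
  move=> pw; rewrite /echain last_map eqxx andbT path_map.
  apply: sub_path pw => y z /andP[yz /asboolP/(_ y)]; apply.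
  by rewrite lexx ltW.
have lestep u w : path step u w -> itv_partition u (last u w) w.
  by move=> pw; split => //; apply: sub_path pw => ? ? /andP[].
have [n] := ubnP (size s + size t).
elim: n => // n IH in a s t ps pt ls lt *.
case: s ps ls => [_ ab|u s pus lus].
  move: lt pt; rewrite /= in ab; rewrite -ab => lta /lestep.
  rewrite lta => /itv_partitionxx -> _; exact: ehomotopic_refl.
case: t pt lt => [_ ab|v t pvt lvt].
  move: lus pus; rewrite /= in ab; rewrite -ab => lua /lestep.
  by rewrite lua => /itv_partitionxx.
wlog uv : u s v t pus lus pvt lvt / u <= v.
  move=> H sz; case: (leP u v) => [|/ltW] uv; first exact: H sz.
  by apply: ehomotopic_sym; apply: H => //; rewrite addnC.
move=> sz; have /= /andP[/andP[au /asboolP Hau] ps] := pus.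
have /= /andP[/andP[av /asboolP Hav] pt] := pvt.
have dau : mdist (g a) (g u) < e by apply: Hau; rewrite lexx ltW.
have cs : echain e (g u) (g b) (map g s) by rewrite -lus; exact: chn.
move: uv; rewrite le_eqVlt => /orP[/eqP uv|uv].
  subst v; apply: ehomotopic_cons => //; apply: IH => //.
  by move: sz; rewrite /= addSn addnS !ltnS => /ltnW.
have puvt : path step u (v :: t).
  rewrite /= pt andbT; apply/andP; split => //; apply/asboolP => r /andP[ur rv].
  by apply: Hav; rewrite rv (le_trans (ltW au)).
apply: (@ehomotopic_trans _ _ _ _ _ (map g (u :: v :: t))).
  by apply: ehomotopic_cons => //; apply: (IH u s (v :: t)).
have cvt : echain e (g u) (g b) (map g (v :: t)).
  by have := chn _ _ puvt; rewrite /= in lvt *; rewrite lvt.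
apply: ehomotopic_sym; apply: (ehomotopic_add (s := map g (v :: t))) => //.
by have := chn _ _ pvt; rewrite lvt.
Qed.

(** Two chains that stay close to each other are homotopic. *)
Lemma close_chains e (T : Type) (g h : T -> X) (a : T) (y : X) (s : seq T)
    (P : rel T) : 0 < e ->
  (forall u v, P u v -> [/\ mdist (g u) (g v) < e, mdist (h u) (h v) < e,
     mdist (g u) (h v) < e & mdist (g u) (h u) < e]) ->
  path P a s -> g a = h a -> g (last a s) = y -> h (last a s) = y ->
  ehomotopic e (g a) y (map g s) (map h s).
Proof.
move=> e0 HP.
have cg (b : T) w : path P b w -> echain e (g b) (g (last b w)) (map g w).
  move=> pw; rewrite /echain last_map eqxx andbT path_map.
  by apply: sub_path pw => ? ? /HP[].
have ch (b : T) w : path P b w -> echain e (h b) (h (last b w)) (map h w).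
  move=> pw; rewrite /echain last_map eqxx andbT path_map.
  by apply: sub_path pw => ? ? /HP[].
suff H (b : T) w : path P b w -> g (last b w) = y -> h (last b w) = y ->
    mdist (g b) (h b) < e ->
    ehomotopic e (g b) y (map g w) (h b :: map h w).
  move=> ps gh gy hy; have dgh : mdist (g a) (h a) < e by rewrite gh mdistxx.
  apply: ehomotopic_trans (H _ _ ps gy hy dgh) _.
  apply: ehomotopic_sym; apply: ehomotopic_add => //.
    by rewrite -hy; exact: ch.
  by rewrite gh -hy; exact: ch.
elim: w b => [b _ /= gy hy dgh|v w IH b pvw gy hy dgh].
  rewrite hy gy; apply: ehomotopic_add; rewrite ?mdistxx// /echain/= eqxx//.
have /= /andP[bv pw] := pvw; have [d1 d2 d3 _] := HP _ _ bv.
have cgw : echain e (g v) y (map g w) by rewrite -gy; exact: cg.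
have chw : echain e (h v) y (map h w) by rewrite -hy; exact: ch.
have dv : mdist (g v) (h v) < e.
  case: w {IH pvw cgw chw} gy hy pw => [/= -> ->|z w _ _ /= /andP[/HP[]]//].
  by rewrite mdistxx.
have c1 : echain e (g b) y (h v :: map h w) by rewrite echain_cons d3.
have c2 : echain e (g v) y (h v :: map h w) by rewrite echain_cons dv.
apply: ehomotopic_trans (ehomotopic_cons d1 cgw (IH v pw gy hy dv)) _.
apply: (@ehomotopic_trans _ _ _ _ _ (h v :: map h w)).
  by apply: ehomotopic_sym; exact: ehomotopic_add.
by apply: ehomotopic_add => //=; rewrite echain_cons d2.
Qed.

Lemma strong_chain_exists e g : 0 < e -> {within `[0, 1], continuous g} ->
  exists s, strong_partition e g 0 1 s.
Proof.
move=> e0 cg; have [d d0 Hd] := heine (@segment_compact _ 0 1) cg e0.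
have [s ps ls] := grid_exists d0; exists s; apply/strong_partitionP; split=> //.
apply: sub_path ps => u v /and4P[u0 uv v1 vud]; rewrite /strong_step uv/=.
apply/asboolP => r /andP[ur rv].
by split; apply: Hd; rewrite /= ?in_itv/= ?/ball/= ?ltr_norml; lra.
Qed.

Lemma strong_chain_homotopy e (x : X) (p q : loop x) s t : 0 < e ->
  loop_homotopic p q ->
  strong_partition e p 0 1 s -> strong_partition e q 0 1 t ->
  ehomotopic e x x (map p s) (map q t).
Proof.
move=> e0 [H [cH Hpq Hx]] ps qt.
have cpt : compact (@unit_square R) by apply: compact_setX; exact: segment_compact.
have [d d0 Hd] := heine cpt cH e0.
have [w pw lw] := grid_exists d0.
have z01 : 0 <= (0 : R) <= 1 by rewrite lexx ler01.
have o01 : 0 <= (1 : R) <= 1 by rewrite lexx ler01.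
have near_square (u v u' v' : R) : 0 <= u <= 1 -> 0 <= v <= 1 ->
    0 <= u' <= 1 -> 0 <= v' <= 1 -> `|u - u'| < d -> `|v - v'| < d ->
    mdist (H (u, v)) (H (u', v')) < e.
  by move=> ? ? ? ? ? ?; apply: Hd; split; rewrite //= in_itv.
have rows v v' : 0 <= v <= 1 -> 0 <= v' <= 1 -> `|v - v'| < d ->
    ehomotopic e x x (map (fun u => H (u, v)) w) (map (fun u => H (u, v')) w).
  move=> v01 v'01 vv'; rewrite -[X in ehomotopic _ X _ _ _](Hx _ v01).1.
  apply: (close_chains (P := fun u u' => [&& 0 <= u, u < u', u' <= 1 & u' - u < d])) => //.
  - move=> u u' /and4P[? ? ? ?].
    by split; apply: near_square; rewrite ?subrr ?normr0// ?ltr_norml; lra.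
  - by rewrite (Hx _ v01).1 (Hx _ v'01).1.
  - by rewrite lw (Hx _ v01).2.
  - by rewrite lw (Hx _ v'01).2.
have allrows w' v : path (fun u u' => [&& 0 <= u, u < u', u' <= 1 & u' - u < d]) v w' ->
    ehomotopic e x x (map (fun u => H (u, v)) w) (map (fun u => H (u, last v w')) w).
  elim: w' v => [v _|v' w' IH v /= /andP[/and4P[v0 vv' v'1 dvv'] pw']].
    exact: ehomotopic_refl.
  apply: ehomotopic_trans (IH _ pw').
  by apply: rows; rewrite ?ltr_norml; lra.
have := allrows _ _ pw; rewrite lw => H01.
have wstrong (r : loop x) v : 0 <= v <= 1 ->
    (forall u : R, 0 <= u <= 1 -> H (u, v) = r u) -> strong_partition e r 0 1 w.
  move=> v01 Hr; apply/strong_partitionP; split => //.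
  apply: sub_path pw => u u' /and4P[u0 uu' u'1 duu']; rewrite /strong_step uu'/=.
  apply/asboolP => k /andP[uk ku'].
  by rewrite -!Hr; [|lra..]; split; apply: near_square;
    rewrite ?subrr ?normr0// ?ltr_norml; lra.
have Hmap (r : loop x) v : (forall u : R, 0 <= u <= 1 -> H (u, v) = r u) ->
    map (fun u => H (u, v)) w = map r w.
  move=> Hr; apply/eq_in_map => u uw; apply: Hr.
  have H01w y : path (fun u u' => [&& 0 <= u, u < u', u' <= 1 & u' - u < d]) y w ->
      all (fun u : R => 0 <= u <= 1) w.
    elim: (w) y => // z w' IH y /= /andP[/and4P[? ? ? _] /IH ->].
    by rewrite andbT; lra.
  have := H01w _ pw.
  by move=> /allP/(_ _ uw).
have Hp u : 0 <= u <= 1 -> H (u, 0) = p u by move=> /Hpq[].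
have Hq u : 0 <= u <= 1 -> H (u, 1) = q u by move=> /Hpq[].
have wp := wstrong _ _ z01 Hp; have wq := wstrong _ _ o01 Hq.
rewrite (Hmap _ _ Hp) (Hmap _ _ Hq) in H01.
have /= := strong_chain_unique e0 ps wp; rewrite loop0 loop1 => hp.
have /= := strong_chain_unique e0 wq qt; rewrite loop0 loop1 => hq.
by apply: ehomotopic_trans hp _; exact: ehomotopic_trans H01 hq.
Qed.

End StrongChains.

Section GeodesicSpace.
Context {R : realType} (X : metricType R).

Definition curve_length (g : R -> X) (a b : R) : \bar R :=
  ereal_sup [set (\sum_(i < size s)
      mdist (g (nth b (a :: s) i)) (g (nth b (a :: s) i.+1)))%:E
    | s in itv_partition a b].

Definition geodesic_space := forall x y : X, exists (a b : R) (g : R -> X),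
  [/\ a <= b, {within `[a, b], continuous g}, g a = x, g b = y &
      curve_length g a b = (mdist x y)%:E].

End GeodesicSpace.

Section EpsilonHomomorphism.
Context {R : realType} {X : metricType R} (x : X).

Section FixedEpsilon.
Context (e : {posnum R}).

Fact strong_eloop_subproof (p : loop x) (s : seq R) :
  strong_partition e%:num p 0 1 s -> echain e%:num x x (map p s).
Proof.
by move=> /strong_partition_echain; rewrite loop0 loop1; apply.
Qed.

Definition strong_eloop (p : loop x) (s : seq R)
    (ps : strong_partition e%:num p 0 1 s) : eloop e%:num x :=
  Sub (map p s) (strong_eloop_subproof ps).

Fact loop_strong_partition (p : loop x) :
  exists s, strong_partition e%:num p 0 1 s.
Proof. exact: strong_chain_exists (gt0 e) (loop_continuous p). Qed.

(** [h_epsE] shows that the chosen strong chain is irrelevant. *)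
Definition h_eps (u : pi1 x) : pi_eps e%:num x :=
  eloop_class (strong_eloop (svalP (cid (loop_strong_partition (repr u))))).

Lemma h_epsE (p : loop x) (s : seq R)
    (ps : strong_partition e%:num p 0 1 s) :
  h_eps (loop_class p) = eloop_class (strong_eloop ps).
Proof.
apply/eloop_classP => /=; apply: strong_chain_homotopy ps => //; last exact: svalP.
by apply/loop_classP; exact: loop_class_repr.
Qed.

Fact h_eps_monoid_morphism : monoid.monoid_morphism h_eps.
Proof.
apply: monoid_morphism_of_mul => u v.
rewrite -(loop_class_repr u) -(loop_class_repr v).
move: (repr u) (repr v) => {u v} p q.
rewrite [(_ * _)%g]pi1_mulE.
have [s ps] := loop_strong_partition p.
have [t qt] := loop_strong_partition q.
have h2 : 0 < 2^-1 :> R by rewrite invr_gt0.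
have Hp (r : R) : 0 <= r <= 1 -> loop_mul p q (2^-1 * r + 0) = p r.
  move=> r01; rewrite /= /loop_mul_fun ifT; last by lra.
  by congr (p _); lra.
have Hq (r : R) : 0 <= r <= 1 -> loop_mul p q (2^-1 * r + 2^-1) = q r.
  move=> r01; rewrite /= /loop_mul_fun; case: ifPn => r2.
    have -> : r = 0 by lra.
    by rewrite mulr0 add0r divff// loop0 loop1.
  by congr (q _); lra.
have [ps' Es] := strong_partition_affine h2 Hp ps.
have [qt' Et] := strong_partition_affine h2 Hq qt.
have E1 : 2^-1 * 0 + 0 = 0 :> R by lra.
have E2 : 2^-1 * 1 + 0 = 2^-1 :> R by lra.
have E3 : 2^-1 * 0 + 2^-1 = 2^-1 :> R by lra.
have E4 : 2^-1 * 1 + 2^-1 = 1 :> R by lra.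
rewrite E1 E2 in ps'; rewrite E3 E4 in qt'.
have pq := strong_partition_cat ps' qt'.
rewrite (h_epsE pq) (h_epsE ps) (h_epsE qt) [RHS]pi_eps_mulE.
by congr eloop_class; apply: val_inj => /=; rewrite map_cat Es Et.
Qed.

HB.instance Definition _ :=
  isUMagmaMorphism.Build (pi1 x) (pi_eps e%:num x) h_eps h_eps_monoid_morphism.

Definition K_eps : set (pi1 x) := [set u | h_eps u = 1%g].

End FixedEpsilon.

Definition pi_cl_set : set (pi1 x) := \bigcap_(e : {posnum R}) K_eps e.

Fact pi_cl1 : pi_cl_set 1%g.
Proof. by move=> e _; rewrite /K_eps /= gmulf1. Qed.

Fact pi_clM u v : pi_cl_set u -> pi_cl_set v -> pi_cl_set (u * v)%g.
Proof.
by move=> hu hv e _; rewrite /K_eps /= gmulfM /= (hu e I) (hv e I) mulg1.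
Qed.

Fact pi_clV u : pi_cl_set u -> pi_cl_set u^-1%g.
Proof.
by move=> hu e _; rewrite /K_eps /= gmulfV /= (hu e I) invg1.
Qed.

Fact pi_clJ u v : pi_cl_set u -> pi_cl_set (u ^ v)%g.
Proof.
move=> hu e _; rewrite /K_eps /= conjgE !gmulfM /= (hu e I) mul1g.
by rewrite -gmulfM mulVg gmulf1.
Qed.

Definition pi_cl : normal_subgroup (pi1 x) :=
  NormalSubgroup pi_cl1 pi_clM pi_clV pi_clJ.

Definition revised_pi1 : groupType := quotient_group pi_cl.

Definition hbar : pi1 x -> revised_pi1 := lcoset_of pi_cl.

HB.instance Definition _ := UMagmaMorphism.on hbar.

End EpsilonHomomorphism.

Section InducedHomomorphism.
Context {R : realType} {X Y : metricType R} (x : X) (y : Y) (f : X -> Y).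
Hypotheses (cf : continuous f) (fxy : f x = y).

Lemma unif_continuous_continuous (g : X -> Y) : unif_continuous g -> continuous g.
Proof.
move=> /unif_continuousP ug z; apply/cvg_ballP => e /ug[d d0 gd].
by near=> w; apply: (gd (z, w)) => /=; near: w; exact: nbhsx_ballx.
Unshelve. all: by end_near. Qed.

Fact loop_map_continuous (p : loop x) : {within `[0, 1], continuous (f \o p)}.
Proof.
apply: (@within_comp R X Y _ setT p f) => //; first exact: loop_continuous.
exact: continuous_subspaceT.
Qed.

Fact loop_map0 (p : loop x) : (f \o p) 0 = y.
Proof. by rewrite /= loop0. Qed.

Fact loop_map1 (p : loop x) : (f \o p) 1 = y.
Proof. by rewrite /= loop1. Qed.

Definition loop_map (p : loop x) : loop y :=
  @Loop R Y y (f \o p) (@loop_map_continuous p) (loop_map0 p) (loop_map1 p).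

Lemma loop_map_homotopic (p q : loop x) :
  loop_homotopic p q -> loop_homotopic (loop_map p) (loop_map q).
Proof.
move=> [H [cH Hpq Hx]]; exists (f \o H); split.
- apply: (within_comp (B := setT) cH) => //; exact: continuous_subspaceT.
- by move=> t /Hpq[/= -> ->].
- by move=> s /Hx[/= -> ->].
Qed.

Definition pi1_map (u : pi1 x) : pi1 y := loop_class (loop_map (repr u)).

Lemma pi1_mapE (p : loop x) : pi1_map (loop_class p) = loop_class (loop_map p).
Proof.
apply/loop_classP; apply: loop_map_homotopic.
by apply/loop_classP; exact: loop_class_repr.
Qed.

Fact pi1_map_monoid_morphism : monoid.monoid_morphism pi1_map.
Proof.
apply: monoid_morphism_of_mul => u v.
rewrite -(loop_class_repr u) -(loop_class_repr v).
rewrite [(_ * _)%g in LHS]pi1_mulE !pi1_mapE [RHS]pi1_mulE.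
apply/loop_classP; apply: eq_loop_homotopic => t _ /=.
by rewrite /loop_mul_fun /=; case: ifP.
Qed.

HB.instance Definition _ :=
  isUMagmaMorphism.Build (pi1 x) (pi1 y) pi1_map pi1_map_monoid_morphism.

End InducedHomomorphism.

Arguments hbar {R X} x.

(* Main.v *)
Require Import Defs.
From HB Require Import structures.
From mathcomp Require Import all_boot all_order all_algebra.
From mathcomp Require Import all_classical all_reals topology normedtype.
From mathcomp Require Import interval_inference.

Import Order.TTheory GRing.Theory Num.Theory.
Local Open Scope classical_set_scope.
Local Open Scope ring_scope.

(** A map [f] such that [mdist u v < d] implies [mdist (f u) (f v) < e] sends
    [d]-chains to [e]-chains, basic moves to basic moves, and a strong
    [d]-chain along a loop [p] to a strong [e]-chain along [f \o p].  So if the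
    class of [p] is killed by [h_eps d], the class of [f \o p] is killed by [h_eps e]:
    apply [f] to a null [d]-homotopy of a strong [d]-chain along [p].  Uniform
    continuity provides such a [d] for every [e], whence [f_*] maps [pi_cl X]
    into [pi_cl Y] ([pi1_map_pi_cl]) and descends to the quotients, as any
    homomorphism that respects two normal subgroups does ([quotient_map]).
    Uniqueness holds because [hbar x] is onto. *)

Definition maps_normal {G H : groupType} (N : normal_subgroup G)
    (M : normal_subgroup H) (phi : G -> H) :=
  forall a, nsg_set N a -> nsg_set M (phi a).

Section QuotientMap.
Context {G H : groupType} {N : normal_subgroup G} {M : normal_subgroup H}.
Context {phi : UMagmaMorphism.type G H}.
Implicit Type phiNM : maps_normal N M phi.

(** The proof [phiNM] is an argument so that the morphism structure, which
    depends on it, can be inferred from the map. *)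
Definition quotient_map phiNM (a : quotient_group N) :
  quotient_group M := lcoset_of M (phi (repr a)).

Lemma quotient_mapE phiNM (a : G) :
  quotient_map phiNM (lcoset_of N a) = lcoset_of M (phi a).
Proof.
have /lcoset_ofP/phiNM Na := lcoset_of_repr (lcoset_of N a).
by apply/lcoset_ofP; rewrite -gmulfV -gmulfM.
Qed.

Fact quotient_map_monoid_morphism phiNM :
  monoid.monoid_morphism (quotient_map phiNM).
Proof.
apply: monoid_morphism_of_mul => a b.
rewrite -(lcoset_of_repr a) -(lcoset_of_repr b).
by rewrite -gmulfM !quotient_mapE !gmulfM.
Qed.

HB.instance Definition _ phiNM := isUMagmaMorphism.Build
  (quotient_group N) (quotient_group M) (quotient_map phiNM)
  (quotient_map_monoid_morphism phiNM).

End QuotientMap.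

(** The classes of two morphisms with the same underlying function are proofs
    of the same proposition. *)
Lemma umagma_morphism_ext (G H : groupType) (k l : UMagmaMorphism.type G H) :
  k =1 l -> k = l.
Proof.
case: k l => [k [[kM] [k1]]] [l [[lM] [l1]]] /= /funext kl.
move: lM l1; rewrite -kl => lM l1.
by rewrite (Prop_irrelevance lM kM) (Prop_irrelevance l1 k1).
Qed.

Section ChainImage.
Context {R : realType} {X Y : metricType R} {f : X -> Y} {d e : R}.
Hypothesis fde : forall u v, mdist u v < d -> mdist (f u) (f v) < e.

Lemma echain_map {x y s} : echain d x y s -> echain e (f x) (f y) (map f s).
Proof.
move=> /andP[ps /eqP <-]; rewrite /echain last_map eqxx andbT path_map.
by apply: sub_path ps => u v; exact: fde.
Qed.

Lemma ehomotopic_map {x y s t} :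
  ehomotopic d x y s t -> ehomotopic e (f x) (f y) (map f s) (map f t).
Proof.
have adds (v w : seq X) : adds_point v w -> adds_point (map f v) (map f w).
  move=> [s1 [z [s2 [-> ->]]]]; exists (map f s1), (f z), (map f s2).
  by rewrite !map_cat.
elim=> [|v w _ IH [cv cw vw]]; first exact: ehomotopic_refl.
apply: ehomotopic_move IH _; split; [exact: echain_map..|].
by case: vw => /adds ?; [left|right].
Qed.

Lemma strong_partition_map {g a b s} :
  strong_partition d g a b s -> strong_partition e (f \o g) a b s.
Proof.
move=> /strong_partitionP[ps ls]; apply/strong_partitionP; split=> //.
apply: sub_path ps => u v /andP[uv /asboolP H]; apply/andP; split=> //.
by apply/asboolP => r /H[? ?]; split; exact: fde.
Qed.

End ChainImage.

Section UniformlyContinuous.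
Context {R : realType} {X Y : metricType R} {x : X} {y : Y} {f : X -> Y}.
Hypothesis fxy : f x = y.

(** The partition of a strong [d]-chain along a loop also gives a strong
    [e]-chain along the image loop, which represents its class under [h_eps];
    the image under [f] of a null homotopy of the first chain is one of the
    second. *)
Lemma K_eps_map (fc : continuous f) {d e : {posnum R}} :
  (forall u v, mdist u v < d%:num -> mdist (f u) (f v) < e%:num) ->
  forall u, K_eps d u -> K_eps e (pi1_map fc fxy u).
Proof.
move=> fde u; rewrite -(loop_class_repr u) /K_eps /= pi1_mapE.
move: (repr u) => p {u}.
have [s ps] := loop_strong_partition d p.
have fps : strong_partition e%:num (loop_map fc fxy p) 0 1 s.
  exact (strong_partition_map fde ps).
rewrite (h_epsE ps) (h_epsE fps) => /eloop_classP /= ps1.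
apply/eloop_classP => /=.
by have := ehomotopic_map fde ps1; rewrite fxy -map_comp.
Qed.

Lemma pi1_map_pi_cl (fc : continuous f) (u : pi1 x) :
  unif_continuous f -> pi_cl_set u -> pi_cl_set (pi1_map fc fxy u).
Proof.
move=> /unif_continuousP fu hu e _.
have [d /= d0 fde] := fu _ (gt0 e).
apply: (@K_eps_map fc (PosNum d0) e _ _ (hu _ I)) => v w vw.
by have := fde (v, w); rewrite /= !ballEmdist; apply.
Qed.

End UniformlyContinuous.

Theorem lemma3p17 (R : realType) (X Y : metricType R)
    (gX : geodesic_space X) (gY : geodesic_space Y)
    (x : X) (y : Y) (f : X -> Y)
    (fu : unif_continuous f) (fxy : f x = y) :
  let fc : continuous f := unif_continuous_continuous fu in
  let f_star : pi1 x -> pi1 y := pi1_map fc fxy in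
  exists f_sharp : UMagmaMorphism.type (revised_pi1 x) (revised_pi1 y),
    unique (fun k : UMagmaMorphism.type (revised_pi1 x) (revised_pi1 y) =>
              k \o hbar x = hbar y \o f_star) f_sharp /\
    forall g : loop x,
      f_sharp (lcoset_of (pi_cl x) (loop_class g)) =
      lcoset_of (pi_cl y) (loop_class (loop_map fc fxy g)).
Proof.
move=> fc f_star.
have f_starN : maps_normal (pi_cl x) (pi_cl y) f_star.
  by move=> u; exact: pi1_map_pi_cl.
pose f_sharp : UMagmaMorphism.type (revised_pi1 x) (revised_pi1 y) :=
  quotient_map f_starN.
have f_sharpE u : f_sharp (hbar x u) = hbar y (f_star u).
  exact: (quotient_mapE f_starN).
exists f_sharp; split; first split.
- exact/funext.
- move=> k kE; apply: umagma_morphism_ext => a.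
  rewrite -(lcoset_of_repr a) -/(hbar x (repr a)) f_sharpE.
  by move/(congr1 (@^~ (repr a))) : kE.
- by move=> g; rewrite -(pi1_mapE fc fxy); exact: f_sharpE.
Qed.
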